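(* Let $p>1$ and let $\psi:\mathbb Z\to[0,\infty)$ be bounded and not identically zero. Consider the problem $$u_t(x,t)=u(x+1,t)+u(x-1,t)-2u(x,t)+u(x,t)^p,\quad (x,t)\in\mathbb Z\times(0,T),\qquad u(x,0)=\psi(x),\quad x\in\mathbb Z .$$ If $$\max\Big\{\liminf_{x\to+\infty}\psi(x),\ \liminf_{x\to-\infty}\psi(x)\Big\}>0,$$ then the solution blows up in finite time, i.e. its life span $T_1$ is finite, and $$T_1\le\frac1{p-1}\Big(\max\Big\{\liminf_{x\to+\infty}\psi(x),\ \liminf_{x\to-\infty}\psi(x)\Big\}\Big)^{1-p}.$$
   Context: A solution in $[0,T)$ of the problem is a function $u:\mathbb Z\times[0,T)\to[0,\infty)$ satisfying the problem such that for each $x\in\mathbb Z$ the function $u(x,\cdot)$ is continuous on $[0,T)$ and $C^1$ on $(0,T)$, and such that $u$ is bounded on $\mathbb Z\times[0,T']$ for every $0<T'<T$. (A unique local solution exists.) The life span is $T_1=\sup\{T>0:\ \text{the problem has a solution in }[0,T)\}\in(0,\infty]$; when finite it is the blow-up time of the solution. *)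

(* Defs.v *)
From HB Require Import structures.
From mathcomp Require Import all_boot all_order all_algebra.
From mathcomp Require Import all_classical all_reals all_analysis.

Set Implicit Arguments.
Unset Strict Implicit.
Unset Printing Implicit Defensive.

Import Order.TTheory GRing.Theory Num.Theory.
Import numFieldNormedType.Exports.

Local Open Scope classical_set_scope.
Local Open Scope ring_scope.

(* limn_inf has a junk value on some unbounded sequences, so these are lower
   limits for bounded f only. *)
Definition liminf_pinfty (R : realType) (f : int -> R) : R :=
  limn_inf (fun n : nat => f n%:Z).

Definition liminf_ninfty (R : realType) (f : int -> R) : R :=
  limn_inf (fun n : nat => f (- n%:Z)).

(* The time variable ranges over the whole of R, but the values of u outside
   [0, T[ are unconstrained. *)
Record is_solution (R : realType) (p : R) (psi : int -> R) (T : R)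
    (u : int -> R -> R) : Prop := IsSolution {
  solution_ge0 : forall (x : int) (t : R), 0 <= t < T -> 0 <= u x t ;
  solution_continuous : forall x : int, {within `[0, T[, continuous (u x)} ;
  solution_derivable : forall x : int, {in `]0, T[, forall t, derivable (u x) t 1} ;
  solution_C1 : forall x : int, {in `]0, T[, continuous (derive1 (u x))} ;
  solution_bounded : forall T' : R, 0 < T' < T ->
    [bounded u xt.1 xt.2 | xt in [set: int] `*` `[0, T'] ] ;
  solution_eq : forall (x : int) (t : R), 0 < t < T ->
    derive1 (u x) t = u (x + 1) t + u (x - 1) t - 2 * u x t + u x t `^ p ;
  solution_init : forall x : int, u x 0 = psi x }.

Definition life_span (R : realType) (p : R) (psi : int -> R) : \bar R :=
  ereal_sup [set T%:E | T in
    [set T : R | 0 < T /\ exists u : int -> R -> R, is_solution p psi T u]].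

(* Main.v *)
(** Far out on the side where the lower limit is attained, average u over a
    window of n consecutive sites.  The discrete Laplacian telescopes to boundary
    terms, which are O(1/n) because u is bounded on [0, T'], and the power mean
    inequality bounds the nonlinear term from below.  Hence the average F
    satisfies F' >= F^p - O(1/n), and letting n tend to infinity compares it with
    y' = y^p, which blows up at time y(0)^(1-p) / (p-1). *)

Require Import Defs.
From HB Require Import structures.
From mathcomp Require Import all_boot all_order all_algebra.
From mathcomp Require Import all_classical all_reals all_analysis.
From mathcomp Require Import ring lra zify.

Import Order.TTheory GRing.Theory Num.Theory.
Import numFieldNormedType.Exports.

Local Open Scope classical_set_scope.
Local Open Scope ring_scope.

Lemma power_mean (R : realType) (p : R) (n : nat) (x : 'I_n -> R) :
  1 < p -> (0 < n)%N -> (forall i, 0 <= x i) ->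
  (n%:R^-1 * \sum_(i < n) x i) `^ p <= n%:R^-1 * \sum_(i < n) x i `^ p.
Proof.
move=> p1 n0 x0; set F := n%:R^-1 * _.
have p0 : 0 < p by lra.
have nR : 0 < n%:R :> R by rewrite ltr0n.
have F0 : 0 <= F by rewrite mulr_ge0 ?invr_ge0 ?ler0n ?sumr_ge0.
(* Young's inequality, i.e. the tangent line of x^p at F. *)
have young i : p * x i * F `^ (p - 1) <= x i `^ p + (p - 1) * F `^ p.
  have q0 : 0 < p / (p - 1) by rewrite divr_gt0 //; lra.
  have pq : p^-1 + (p / (p - 1))^-1 = 1 by field; lra.
  have := conjugate_powR (x0 i) (powR_ge0 F (p - 1)) p0 q0 pq.
  rewrite -powRrM (mulrC (p - 1)) divfK ?gt_eqF //; last by lra.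
  rewrite -(ler_pM2l p0) mulrA => /le_trans; apply.
  by rewrite le_eqVlt; apply/orP; left; apply/eqP; field; lra.
have : \sum_(i < n) (p * x i * F `^ (p - 1)) <=
    \sum_(i < n) (x i `^ p + (p - 1) * F `^ p).
  by apply: ler_sum => i _; exact: young.
have Fsum : \sum_(i < n) x i = n%:R * F by rewrite /F mulVKf // gt_eqF.
rewrite -mulr_suml -mulr_sumr Fsum big_split /= sumr_const card_ord.
(* As [F] is the mean of the [x i], the left sides add up to [n p F^p]. Moving the constants
   [n (p - 1) F^p] across leaves [n F^p]. *)
have -> : p * (n%:R * F) * F `^ (p - 1) = n%:R * (p * F `^ p).
  by rewrite -(mulr_powRB1 F0 p0); ring.
rewrite -mulr_natl => h.
rewrite ler_pdivlMl //; lra.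
Qed.

Lemma powR_continuous_at (R : realType) (a x : R) :
  0 < x -> y `^ a @[y --> x] --> x `^ a.
Proof.
move=> x0; apply: (@differentiable_continuous _ _ _ _ (fun y : R => y `^ a)).
by apply/derivable1_diffP; have [] := is_derive1_powR a x0.
Qed.

Lemma within_continuous_powR (R : realType) (A : set R) (F : R -> R) (a : R) :
  {within A, continuous F} -> (forall t, A t -> 0 < F t) ->
  {within A, continuous (fun t => F t `^ a)}.
Proof.
move=> cF F0; rewrite continuous_subspace_in => t; rewrite inE => At.
exact: (cvg_comp _ _ (cF t) (powR_continuous_at _ _ _ (F0 _ At))).
Qed.

Lemma blowup_time_le (R : realType) (p m eps eta T : R) (F dF : R -> R) :
  1 < p -> 0 < m -> 0 <= eps -> 0 < T -> eps <= eta * m `^ p ->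
  {within `[0, T], continuous F} ->
  (forall t, t \in `]0, T[ -> is_derive t 1 F (dF t)) ->
  (forall t, t \in `]0, T[ -> F t `^ p - eps <= dF t) ->
  m + eps * T <= F 0 ->
  (p - 1) * (1 - eta) * T <= m `^ (1 - p).
Proof.
(* F >= m because F decreases at rate at most eps; then F^p - eps >= (1 - eta) F^p,
   so F^(1-p) + (p-1)(1-eta) t is nonincreasing. *)
move=> p1 m0 eps0 T0 epseta cF derF dFge F0.
have Fge t : t \in `[0, T] -> m <= F t.
  rewrite in_itv /= le_eqVlt => /andP[/orP[/eqP <-|t0] tT].
    by apply: le_trans F0; rewrite lerDl mulr_ge0 // ltW.
  have sub s : s \in `]0, t[ -> s \in `]0, T[.
    by rewrite !in_itv /= => /andP[-> /lt_le_trans->].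
  have [||s /sub sI E] := @MVT R F dF 0 t t0.
  - by move=> s /sub; exact: derF.
  - apply: continuous_subspaceW cF => s /=.
    by rewrite !in_itv /= => /andP[-> /le_trans->].
  have := dFge s sI; have := powR_ge0 (F s) p; rewrite subr0 in E => h1 h2.
  have : - eps * t <= dF s * t by rewrite ler_pM2r //; lra.
  have : eps * t <= eps * T by rewrite ler_wpM2l.
  lra.
have [||s sI] := @MVT R (fun t => F t `^ (1 - p) + (p - 1) * (1 - eta) * t)
  (fun t => (1 - p) * F t `^ (- p) * dF t + (p - 1) * (1 - eta)) 0 T T0.
- move=> t tI.
  have Ft : 0 < F t.
    by apply: lt_le_trans (Fge t _) => //; exact: subset_itv_oo_cc.
  have d1 := is_derive1_comp (is_derive1_powR (1 - p) Ft) (derF t tI).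
  have d2 : is_derive t 1 (fun t => (p - 1) * (1 - eta) * t)
    ((p - 1) * (1 - eta)).
    by apply: is_derive_eq (is_deriveZ _ (is_derive_id t 1)) _; exact: mulr1.
  apply: is_derive_eq (is_deriveD d1 d2) _.
  by congr (_ * _ `^ _ * _ + _); lra.
- apply: within_continuousD.
    apply: within_continuous_powR cF _ => s sI.
    by apply: lt_le_trans (Fge s _).
  apply: continuous_subspaceT => t.
  exact: (@mulrl_continuous R).
rewrite mulr0 addr0 subr0 => E.
have sF := Fge s (subset_itv_oo_cc sI).
have Fs0 : 0 < F s by lra.
have le0 : (1 - p) * F s `^ (- p) * dF s + (p - 1) * (1 - eta) <= 0.
  have mF : m `^ p <= F s `^ p.
    by rewrite ge0_ler_powR ?nnegrE //; lra.
  have Fp0 : 0 < F s `^ p by rewrite powR_gt0.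
  have eta0 : 0 <= eta.
    have := le_trans eps0 epseta; rewrite pmulr_lge0 // powR_gt0 //.
  have h : (1 - eta) * F s `^ p <= dF s.
    apply: le_trans (dFge s sI).
    have : eta * m `^ p <= eta * F s `^ p by rewrite ler_wpM2l.
    lra.
  have : 1 - eta <= F s `^ (- p) * dF s.
    by rewrite powRN ler_pdivlMl // mulrC.
  move=> {}h.
  have : (p - 1) * (1 - eta) <= (p - 1) * (F s `^ (- p) * dF s).
    by rewrite ler_wpM2l //; lra.
  lra.
have HT : ((1 - p) * F s `^ (- p) * dF s + (p - 1) * (1 - eta)) * T <= 0.
  by rewrite pmulr_lle0.
(* The exponent [1 - p] is negative, so [m <= F 0] is reversed. *)
have F0m : F 0 `^ (1 - p) <= m `^ (1 - p).
  have mF0 : m <= F 0 by apply: Fge; rewrite in_itv /= lexx ltW.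
  rewrite -[1 - p]opprB !powRN lef_pV2 ?posrE ?powR_gt0 //; last by lra.
  by rewrite ge0_ler_powR ?nnegrE //; lra.
(* Monotonicity gives [F(T)^(1-p) + (p-1)(1-eta) T <= F(0)^(1-p)]. The first term is dropped because
   it is nonnegative, and [F0m] bounds the right side. *)
have := powR_ge0 (F T) (1 - p).
lra.
Qed.

(** The second difference is a difference of first differences, so the sum telescopes to one first
    difference at each end: four values of [f], whatever [n] is. *)
Lemma sum_discrete_laplacian (R : realType) (f : int -> R) (a : int) (n : nat) :
  \sum_(i < n) (f (a + i%:Z + 1) + f (a + i%:Z - 1) - 2 * f (a + i%:Z)) =
  f (a + n%:Z) - f (a + n%:Z - 1) + f (a - 1) - f a.
Proof.
elim: n => [|n IHn]; first by rewrite big_ord0 addr0; lra.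
rewrite big_ord_recr /= IHn -[n.+1]addn1 PoszD !addrA addrK; lra.
Qed.

Lemma within_continuous_sum (R : realType) (A : set R) (n : nat)
    (f : 'I_n -> R -> R) :
  (forall i, {within A, continuous (f i)}) ->
  {within A, continuous (\sum_(i < n) f i)}.
Proof.
move=> cf; elim/big_ind: _ => [|g h cg ch|i _]; last exact: cf.
  by apply: continuous_subspaceT => t; exact: cst_continuous.
exact: within_continuousD.
Qed.

(** The window may move with [n], because the bound on [u] over [[0, T']] is uniform in space. The
    gap between [m'] and [m] pays for what the average can lose through the boundary terms. *)
Lemma solution_time_le (R : realType) (p m m' T T' : R) (psi : int -> R)
    (u : int -> R -> R) :
  1 < p -> 0 < m' -> m' < m -> 0 < T' -> T' < T -> is_solution p psi T u ->
  (forall n, exists a : int, forall i, (i < n)%N -> m <= psi (a + i%:Z)) ->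
  (p - 1) * T' <= m' `^ (1 - p).
Proof.
move=> p1 m'0 m'm T'0 T'T [u0 uc ud _ ub ueq ui] window.
have [C C0 uC] : exists2 C, 0 < C &
    forall x t, 0 <= t <= T' -> 0 <= u x t <= C.
  have [|M [_ /(_ (`|M| + 1))]] := ub T'; first by rewrite T'0.
  rewrite ltr_pwDr ?ler_norm // => /(_ isT) uM.
  exists (`|M| + 1) => [|x t /andP[t0 tT]]; first by rewrite ltr_wpDl.
  rewrite u0 ?t0 ?(le_lt_trans tT) //=.
  apply: le_trans (ler_norm _) (uM (x, t) _).
  by split => //=; rewrite in_itv /= t0.
apply/ler_addgt0Pr => e e0.
have pT0 : 0 < (p - 1) * T' by rewrite mulr_gt0 //; lra.
(* Chosen so that [(p - 1) * eta * T' = e]: the loss from [eta] is exactly the allowed error. *)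
pose eta := e / ((p - 1) * T').
have eta0 : 0 < eta by rewrite divr_gt0.
(* The first entry gives [m' + eps * T' <= m], hence the initial condition of [blowup_time_le]; the
   second gives its hypothesis relating [eps] and [eta]. *)
pose eps := Num.min ((m - m') / T') (eta * m' `^ p).
have eps0 : 0 < eps.
  by rewrite lt_min divr_gt0 ?subr_gt0 // mulr_gt0 ?powR_gt0.
(* The four boundary values lie in [[0, C]], two with each sign, so their total is at least
   [- 2 * C]; divided by this [n] it is at least [- eps]. *)
pose n := (Num.truncn (2 * C / eps)).+1.
have nC : 2 * C / eps < n%:R by exact: truncnS_gt.
have nR : 0 < n%:R :> R by rewrite ltr0n.
have [a apsi] := window n.
pose v i := u (a + (i : 'I_n)%:Z).
pose dv (i : 'I_n) t := derive1 (v i) t.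
pose F := n%:R^-1 \*: \sum_(i < n) v i.
pose dF t := n%:R^-1 * \sum_(i < n) dv i t.
have FE t : F t = n%:R^-1 * \sum_(i < n) v i t by rewrite /F /= fct_sumE.
have sub t : t \in `]0, T'[ -> 0 < t < T.
  by rewrite in_itv /= => /andP[-> /lt_trans ->].
suff : (p - 1) * (1 - eta) * T' <= m' `^ (1 - p).
  have -> : (p - 1) * (1 - eta) * T' = (p - 1) * T' - e.
    by rewrite /eta; field; lra.
  lra.
apply: (@blowup_time_le R p m' eps eta T' F dF) => //.
- exact: ltW.
- by rewrite /eps ge_min lexx orbT.
- apply: (@continuous_subspaceW _ _ _ `[0, T[).
    by move=> t /=; rewrite !in_itv /= => /andP[-> /le_lt_trans ->].
  have cS : {within `[0, T[, continuous (\sum_(i < n) v i)}.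
    by apply: within_continuous_sum => i; exact: uc.
  move=> t; exact: (cvg_comp _ _ (cS t) (@mulrl_continuous R _ _)).
- move=> t /sub tI.
  apply: is_deriveZ; apply: is_derive_sum => i.
  by rewrite /dv derive1E; apply/derivableP/ud; rewrite in_itv.
- move=> t tI'; have tI := sub _ tI'.
  have tcc : 0 <= t <= T' by have := subset_itv_oo_cc tI'; rewrite in_itv.
  rewrite /dF; under eq_bigr do rewrite /dv /v ueq //.
  rewrite big_split /= (sum_discrete_laplacian _ (u ^~ t)) mulrDr.
  have Jensen : F t `^ p <= n%:R^-1 * \sum_(i < n) v i t `^ p.
    rewrite FE; apply: power_mean => // i.
    by have /andP[] := uC (a + i%:Z) t tcc.
  rewrite addrC lerD // lerNl -mulrN ler_pdivrMl //.
  have /andP[? ?] := uC (a + n%:Z) t tcc.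
  have /andP[? ?] := uC (a + n%:Z - 1) t tcc.
  have /andP[? ?] := uC (a - 1) t tcc.
  have /andP[? ?] := uC a t tcc.
  have : 2 * C < n%:R * eps by rewrite -ltr_pdivrMr.
  lra.
- rewrite FE ler_pdivlMl //.
  apply: (@le_trans _ _ (\sum_(i < n) m)); last first.
    by apply: ler_sum => i _; rewrite /v ui; exact: apsi.
  rewrite sumr_const card_ord -[m *+ _]mulr_natl ler_pM2l //.
  have : eps <= (m - m') / T' by rewrite /eps ge_min lexx.
  by rewrite ler_pdivlMr //; lra.
Qed.

(** For a bounded sequence the lower limit is the supremum of the infima of the tails, so one of
    these infima already exceeds [m]. Boundedness also makes that infimum a genuine lower bound of
    its tail. *)
Lemma limn_inf_eventually_ge (R : realType) (v : nat -> R) (m : R) :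
  bounded_fun v -> m < limn_inf v ->
  exists N, forall k, (N <= k)%N -> m <= v k.
Proof.
move=> vb; rewrite limn_infE // => /sup_gt[|_ [N _ <-] mN].
  by exists (infs v 0%N), 0%N.
exists N => k Nk; apply: le_trans (ltW mN) (ge_inf _ _).
  exact/has_lbound_sdrop/bounded_fun_has_lbound.
by exists k.
Qed.

Lemma liminf_window (R : realType) (psi : int -> R) (m : R) :
  bounded_fun psi -> m < Num.max (liminf_pinfty psi) (liminf_ninfty psi) ->
  forall n, exists a : int, forall i, (i < n)%N -> m <= psi (a + i%:Z).
Proof.
move=> [M [Mr psiM]].
have bounded (f : nat -> int) : bounded_fun (psi \o f).
  by exists M; split => // x Mx k _; exact: psiM.
rewrite lt_max => /orP[] /limn_inf_eventually_ge[|N psiN n].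
- exact: bounded.
- by exists N%:Z => i _; rewrite -PoszD; apply: psiN; exact: leq_addr.
- exact: bounded.
(* Windows extend to the right, so on the negative side the window starts [n] sites beyond [-N] and
   stays to the left of [-N]. *)
exists (- (N + n)%:Z) => i ltin.
have -> : - (N + n)%:Z + i%:Z = - (N + n - i)%:Z by lia.
by apply: psiN; lia.
Qed.

Theorem theorem1p5 (R : realType) (p : R) (psi : int -> R)
    (p_gt1 : 1 < p)
    (psi_ge0 : forall x : int, 0 <= psi x)
    (psi_bounded : bounded_fun psi)
    (psi_neq0 : exists x : int, psi x != 0)
    (liminf_gt0 : 0 < Num.max (liminf_pinfty psi) (liminf_ninfty psi)) :
  (life_span p psi < +oo)%E /\
  (life_span p psi <=
    ((p - 1)^-1 *
     Num.max (liminf_pinfty psi) (liminf_ninfty psi) `^ (1 - p))%:E)%E.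
Proof.
set L := Num.max _ _ in liminf_gt0 *.
suff le_span : (life_span p psi <= ((p - 1)^-1 * L `^ (1 - p))%:E)%E.
  by split => //; exact: le_lt_trans le_span (ltry _).
apply: ub_ereal_sup => _ [T [T0 [u sol]] <-]; rewrite lee_fin.
have p10 : 0 < p - 1 by lra.
rewrite ler_pdivlMl //.
(* The midpoint of [m] and [L] serves as the level of the windows: it is below [L], so windows
   exist, and above [m], as [solution_time_le] requires. *)
have below m T' : 0 < m < L -> 0 < T' < T -> (p - 1) * T' <= m `^ (1 - p).
  move=> /andP[m0 mL] /andP[T'0 T'T].
  apply: (@solution_time_le R p ((m + L) / 2) m T T' psi u) => //; first lra.
  by apply: liminf_window => //; rewrite -/L; lra.
(* If [T] exceeded the bound, some [T' < T] would exceed it too. By continuity of the power at [L],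
   a level [m < L] close enough to [L] then contradicts [below]. *)
rewrite leNgt; apply/negP => Llt.
have [T' /andP[LT' T'T]] : exists T', L `^ (1 - p) / (p - 1) < T' < T.
  have h : L `^ (1 - p) / (p - 1) < T by rewrite ltr_pdivrMr // mulrC.
  by have [] := midf_lt h; exists ((L `^ (1 - p) / (p - 1) + T) / 2); lra.
rewrite ltr_pdivrMr // mulrC in LT'.
have [m [[m0 mL] mT']] : exists m, (0 < m /\ m < L) /\ m `^ (1 - p) < (p - 1) * T'.
  apply: (@filter_ex _ L^'-); near=> m; split; first split; near: m.
  - exact: nbhs_left_gt.
  - exact: nbhs_left_lt.
  - exact: (cvgr_lt _ (cvg_at_left_filter (powR_continuous_at _ _ _ liminf_gt0))).
have T'0 : 0 < T'.
  have := powR_ge0 L (1 - p); rewrite -(pmulr_rgt0 _ p10); lra.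
have := below m T'; rewrite m0 mL T'0 T'T => /(_ isT isT); lra.
Unshelve. all: by end_near.
Qed.
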